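(* For the random batch particle method of type I with forward Euler time discretization (the algorithm described in the context), the discrete mass and momentum are conserved exactly, while the discrete energy is conserved up to $O(\Delta t)$. Namely, for every time step $n$ and every choice of batches, $$\sum_{i=1}^N w_i=\text{const},\qquad \frac{\sum_{i=1}^N w_iv_i^{n+1}-\sum_{i=1}^N w_iv_i^n}{\Delta t}=0,\qquad \frac{\sum_{i=1}^N w_i|v_i^{n+1}|^2-\sum_{i=1}^N w_i|v_i^n|^2}{\Delta t}=O(\Delta t),$$ where $O(\Delta t)$ means bounded in absolute value by $C\Delta t$, with $C$ independent of $\Delta t$ for a given current configuration $(v_i^n)_{i=1}^N$, weights, batches and other parameters.
   Context: Let $d\ge2$, $\Lambda>0$, $-d-1\le\gamma\le1$, and let $A(z)=\Lambda|z|^\gamma(|z|^2I_d-z\otimes z)$ for $z\in\mathbb{R}^d$; this is a symmetric positive semi-definite matrix with $A(z)=A(-z)$ and $A(z)z=0$. Let $\epsilon>0$ and $\psi_\epsilon(v)=(2\pi\epsilon)^{-d/2}\exp(-|v|^2/(2\epsilon))$ on $\mathbb{R}^d$. Algorithm (random batch particle method for the homogeneous Landau equation, type I). Parameters: number of particles per dimension $n_o$, $N=n_o^d$; time step $\Delta t>0$; closeness parameter $\sigma>0$; batch size $p\ge2$ dividing $N$; velocity domain $[-L,L]^d$, $h=2L/n_o$, divided into $N$ cubes of side $h$ with centers $v_l^c$, $l=1,\dots,N$. The particles have time-independent weights $w_k>0$ and initial velocities $v_k^0\in\mathbb{R}^d$. At each time step $n=0,1,\dots$: Step 1: $f_l^c=\sum_{k\in\mathcal{A}_l}w_k\psi_\epsilon(v_l^c-v_k^n)$,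 where $\mathcal{A}_l=\{k:|v_l^c-v_k^n|\le\sigma\}$, for $l=1,\dots,N$. Step 2: $F_i=\sum_{l\in\mathcal{B}_i}h^d\,\nabla\psi_\epsilon(v_i^n-v_l^c)\log f_l^c$, where $\mathcal{B}_i=\{l:|v_i^n-v_l^c|\le\sigma\}$, for $i=1,\dots,N$. Step 3: randomly divide the $N$ particles into $q=N/p$ batches $\mathcal{C}_1,\dots,\mathcal{C}_q$ of size $p$; for each batch $\mathcal{C}_r$ and each $i\in\mathcal{C}_r$, define $v_i^{n+1}$ by $$\frac{v_i^{n+1}-v_i^n}{\Delta t}=-\frac{N-1}{p-1}\sum_{j\in\mathcal{C}_r}w_jA(v_i^n-v_j^n)(F_i-F_j).$$ Convention: when $v_i^n=v_j^n$ (in particular when $i=j$), the term $A(v_i^n-v_j^n)(F_i-F_j)$ is taken to be $0$. (For $l\in\mathcal{B}_i$ one has $i\in\mathcal{A}_l$, so $f_l^c>0$ and the logarithms are well defined.) *)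

(* Defs.v *)
From mathcomp Require Import all_boot all_order all_algebra.
From mathcomp Require Import reals topology normedtype sequences derive exp trigo.

Set Implicit Arguments.
Unset Strict Implicit.
Unset Printing Implicit Defensive.

Import Order.TTheory GRing.Theory Num.Theory numFieldNormedType.Exports.
Local Open Scope ring_scope.

(* The library norm `|v| on 'cV[R]_d is the max norm, hence a separate
   Euclidean norm. *)
Definition enorm (R : realType) (d : nat) (v : 'cV[R]_d) : R :=
  Num.sqrt (\sum_(k < d) v k 0 ^+ 2).

(* A(z) = Lambda |z|^gamma (|z|^2 I_d - z (x) z).  For gamma <> 0, powR gives
   0 `^ gamma = 0; in every case A(0) is the zero matrix because its second
   factor vanishes.  This realizes the convention that
   A(v_i - v_j)(F_i - F_j) is 0 when v_i = v_j, for negative gamma as well. *)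
Definition collision_kernel (R : realType) (d : nat) (Lambda gamma : R)
    (z : 'cV[R]_d) : 'M[R]_d :=
  (Lambda * enorm z `^ gamma) *: ((enorm z ^+ 2)%:M - z *m z^T).

Definition mollifier (R : realType) (d : nat) (eps : R) (v : 'cV[R]_d) : R :=
  (2 * pi * eps) `^ (- (d%:R / 2)) * expR (- (enorm v ^+ 2 / (2 * eps))).

Definition gradient (R : realType) (d : nat) (f : 'cV[R]_d -> R)
    (v : 'cV[R]_d) : 'cV[R]_d :=
  \col_(k < d) 'D_(delta_mx k 0) f v.

Definition cell_side (R : realType) (L : R) (no : nat) : R := 2 * L / no%:R.

(* The no ^ d cells of [-L, L]^d are indexed by their integer coordinates
   l : {ffun 'I_d -> 'I_no} instead of a linear numbering; cell l is the
   product over k of the intervals [-L + l_k h, -L + (l_k + 1) h]. *)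
Definition cell_center (R : realType) (d : nat) (L : R) (no : nat)
    (l : {ffun 'I_d -> 'I_no}) : 'cV[R]_d :=
  \col_(k < d) (- L + ((l k)%:R + 2^-1) * cell_side L no).

Record particles (R : realType) (d N : nat) : Type := Particles {
  weight : 'I_N -> R;
  velocity : 'I_N -> 'cV[R]_d
}.

Section Observables.
Context {R : realType} {d N : nat}.
Implicit Type X : particles R d N.

Definition mass X : R := \sum_i weight X i.
Definition momentum X : 'cV[R]_d := \sum_i weight X i *: velocity X i.
Definition energy X : R := \sum_i weight X i * enorm (velocity X i) ^+ 2.

End Observables.

(* f_l^c *)
Definition cell_density (R : realType) (d : nat) (eps sigma L : R) (no : nat)
    (X : particles R d (no ^ d)) (l : {ffun 'I_d -> 'I_no}) : R :=
  let c := cell_center L l in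
  \sum_(k | enorm (c - velocity X k) <= sigma)
     weight X k * mollifier eps (c - velocity X k).

(* F_i *)
Definition force (R : realType) (d : nat) (eps sigma L : R) (no : nat)
    (X : particles R d (no ^ d)) (i : 'I_(no ^ d)) : 'cV[R]_d :=
  \sum_(l : {ffun 'I_d -> 'I_no}
         | enorm (velocity X i - cell_center L l) <= sigma)
     (cell_side L no ^+ d * ln (cell_density eps sigma L X l)) *:
       gradient (@mollifier R d eps) (velocity X i - cell_center L l).

(* A possible outcome of the random division: N / p batches of size p. *)
Definition is_batching (N p : nat) (P : {set {set 'I_N}}) : Prop :=
  [/\ partition P [set: 'I_N], #|P| = (N %/ p)%N &
      forall C : {set 'I_N}, C \in P -> #|C| = p].

(* One forward Euler step of length dt with batches P; pblock P i is the batch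
   that contains particle i. *)
Definition rbm_step (R : realType) (d : nat)
    (Lambda gamma eps sigma L : R) (no p : nat) (dt : R)
    (P : {set {set 'I_(no ^ d)}}) (X : particles R d (no ^ d)) :
    particles R d (no ^ d) :=
  let v := velocity X in
  let F := force eps sigma L X in
  Particles (weight X) (fun i =>
    v i - (dt * (((no ^ d)%:R - 1) / (p%:R - 1))) *:
      \sum_(j in pblock P i)
         weight X j *: (collision_kernel Lambda gamma (v i - v j) *m (F i - F j))).

Fixpoint rbm_run (R : realType) (d : nat)
    (Lambda gamma eps sigma L : R) (no p : nat) (dt : R)
    (B : nat -> {set {set 'I_(no ^ d)}}) (X0 : particles R d (no ^ d))
    (n : nat) : particles R d (no ^ d) :=
  if n is m.+1 then
    rbm_step Lambda gamma eps sigma L p dt (B m)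
      (rbm_run Lambda gamma eps sigma L p dt B X0 m)
  else X0.

(* Main.v *)
Require Import Defs.
From mathcomp Require Import all_boot all_order all_algebra.
From mathcomp Require Import reals topology normedtype sequences derive exp trigo.
From mathcomp Require Import ring.
Import Order.TTheory GRing.Theory Num.Theory numFieldNormedType.Exports.
Local Open Scope ring_scope.

(** One step moves particle [i] by a multiple of its drift, a sum over its
    batch of the pair terms [w_j A(v_i - v_j) (F_i - F_j)].  After weighting by
    [w_i], swapping [i] and [j] flips the sign of a pair term, because [A] is
    even; the drifts therefore have weighted sum zero, which is conservation
    of momentum ([sum_drift]).  Paired with [v_i], the weighted drifts sum to
    half the sum over pairs of [(v_i - v_j) . w_i w_j A(v_i - v_j) (F_i - F_j)],
    which vanishes because [A] is symmetric and [A(z) z = 0]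
    ([sum_dot_drift]).

    Hence the part of the energy increment that is linear in the time step
    cancels, and only the quadratic remainder of the Euler step is left.  It is
    exactly [dt ^ 2] times a quantity computed from the current configuration
    and batches ([energy_step]), so the energy increment divided by [dt] is
    linear in [dt]. *)

Lemma sum_antisymmetric (R : numFieldType) (V : lmodType R) (I : finType)
    (r : rel I) (h : I -> I -> V) :
  symmetric r -> (forall i j, h j i = - h i j) ->
  \sum_i \sum_(j | r i j) h i j = 0.
Proof.
move=> r_sym h_anti; set s := \sum_i _.
have s_opp : s = - s.
  rewrite {1}/s (exchange_big_dep xpredT) //= /s -sumrN; apply: eq_bigr => j _.
  by rewrite -sumrN; apply: eq_big => [i|i _]; [rewrite r_sym | exact: h_anti].
have : 2%:R *: s = 0 by rewrite scaler_nat mulr2n {2}s_opp subrr.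
by move/eqP; rewrite scaler_eq0 pnatr_eq0 /= => /eqP.
Qed.

Lemma pblock_sym (T : finType) (P : {set {set T}}) :
  partition P [set: T] -> symmetric (fun i j => j \in pblock P i).
Proof.
case/and3P=> /eqP P_cover P_triv _ i j.
by rewrite -!eq_pblock ?P_cover ?inE // eq_sym.
Qed.

Definition dot {R : realType} {d : nat} (u v : 'cV[R]_d) : R :=
  (u^T *m v) 0 0.

Section DotProduct.
Context {R : realType} {d : nat}.
Implicit Types u v z : 'cV[R]_d.

Lemma dotDl u v z : dot (u + v) z = dot u z + dot v z.
Proof. by rewrite /dot linearD mulmxDl mxE. Qed.

Lemma dotZl a u z : dot (a *: u) z = a * dot u z.
Proof. by rewrite /dot linearZ /= -scalemxAl mxE. Qed.

Lemma dotC u v : dot u v = dot v u.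
Proof. by rewrite /dot !mxE; apply: eq_bigr => k _; rewrite !mxE mulrC. Qed.

Lemma dotZr a u z : dot u (a *: z) = a * dot u z.
Proof. by rewrite dotC dotZl dotC. Qed.

Lemma dotNr u z : dot u (- z) = - dot u z.
Proof. by rewrite -scaleN1r dotZr mulN1r. Qed.

Lemma dotBl u v z : dot (u - v) z = dot u z - dot v z.
Proof. by rewrite dotDl -scaleN1r dotZl mulN1r. Qed.

Lemma dot_sumr u (I : finType) (r : pred I) (f : I -> 'cV[R]_d) :
  dot u (\sum_(j | r j) f j) = \sum_(j | r j) dot u (f j).
Proof. by rewrite /dot mulmx_sumr summxE. Qed.

Lemma enorm_sqr v : enorm v ^+ 2 = dot v v.
Proof.
rewrite sqr_sqrtr; last by apply: sumr_ge0 => k _; exact: sqr_ge0.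
by rewrite /dot !mxE; apply: eq_bigr => k _; rewrite !mxE expr2.
Qed.

Lemma dot_subZ a v z :
  dot (v - a *: z) (v - a *: z) =
  dot v v - 2 * a * dot v z + a ^+ 2 * dot z z.
Proof.
rewrite dotBl dotZl !(dotC _ (v - _)) !dotBl !dotZl (dotC z v).
by ring.
Qed.

End DotProduct.

Section CollisionKernel.
Context {R : realType} {d : nat} (Lambda gamma : R).
Implicit Types z F : 'cV[R]_d.

Lemma collision_kernelN z :
  collision_kernel Lambda gamma (- z) = collision_kernel Lambda gamma z.
Proof.
have enormN : enorm (- z) = enorm z.
  by congr Num.sqrt; apply: eq_bigr => k _; rewrite mxE sqrrN.
by rewrite /collision_kernel enormN linearN /= mulNmx mulmxN opprK.
Qed.

(** Up to a scalar, [A(z)] is the projection orthogonal to [z]. *)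
Lemma dot_collision_kernel z F :
  dot z (collision_kernel Lambda gamma z *m F) = 0.
Proof.
suff zA0 : z^T *m collision_kernel Lambda gamma z = 0.
  by rewrite /dot mulmxA zA0 mul0mx mxE.
rewrite /collision_kernel -scalemxAr mulmxBr mulmxA mul_mx_scalar.
by rewrite (mx11_scalar (z^T *m z)) mul_scalar_mx enorm_sqr subrr scaler0.
Qed.

End CollisionKernel.

Section Step.
Context {R : realType} {d : nat} (Lambda gamma eps sigma L : R) (no p : nat).
Variables (P : {set {set 'I_(no ^ d)}}) (X : particles R d (no ^ d)).
Hypothesis P_part : partition P [set: 'I_(no ^ d)].

Definition drift (i : 'I_(no ^ d)) : 'cV[R]_d :=
  let v := velocity X in
  let F := force eps sigma L X in
  \sum_(j in pblock P i)
     weight X j *: (collision_kernel Lambda gamma (v i - v j) *m (F i - F j)).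

Let pair_term (i j : 'I_(no ^ d)) : 'cV[R]_d :=
  (weight X i * weight X j) *:
    (collision_kernel Lambda gamma (velocity X i - velocity X j) *m
       (force eps sigma L X i - force eps sigma L X j)).

Let pair_term_swap i j : pair_term j i = - pair_term i j.
Proof.
rewrite /pair_term; move: (force eps sigma L X) => F.
rewrite -(opprB (velocity X i) (velocity X j)) collision_kernelN.
rewrite -(opprB (F i) (F j)).
by rewrite mulmxN scalerN (mulrC (weight X j)).
Qed.

Let weighted_drift i :
  weight X i *: drift i = \sum_(j in pblock P i) pair_term i j.
Proof. by rewrite scaler_sumr; apply: eq_bigr => j _; rewrite scalerA. Qed.

Lemma sum_drift : \sum_i weight X i *: drift i = 0.
Proof.
under eq_bigr do rewrite weighted_drift.
exact: (sum_antisymmetric _ _ _ _ pair_term (pblock_sym _ _ P_part)).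
Qed.

Lemma sum_dot_drift : \sum_i weight X i * dot (velocity X i) (drift i) = 0.
Proof.
under eq_bigr do rewrite -dotZr weighted_drift dot_sumr.
apply: (sum_antisymmetric _ R^o _ _
  (fun i j => dot (velocity X i) (pair_term i j)) (pblock_sym _ _ P_part)).
(* The pair term is orthogonal to [v_i - v_j], so [v_i] may replace [v_j]. *)
move=> i j; rewrite pair_term_swap dotNr; congr (- _).
apply/eqP; rewrite eq_sym -subr_eq0 -dotBl /pair_term dotZr.
by rewrite dot_collision_kernel mulr0.
Qed.

(** The factor [(N - 1) / (p - 1)] that compensates for restricting each
    particle to the [p - 1] partners of its batch. *)
Definition batch_factor : R := ((no ^ d)%:R - 1) / (p%:R - 1).

Lemma momentum_step dt :
  momentum (rbm_step Lambda gamma eps sigma L p dt P X) = momentum X.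
Proof.
rewrite /momentum /=.
under eq_bigr do rewrite -/(drift _) scalerBr scalerA mulrC -scalerA.
by rewrite sumrB -scaler_sumr sum_drift scaler0 subr0.
Qed.

Definition energy_drift : R :=
  batch_factor ^+ 2 * \sum_i weight X i * dot (drift i) (drift i).

(** The cross term [- 2 dt v_i . drift_i] of the expanded square disappears
    from the weighted sum, so no first-order contribution survives. *)
Lemma energy_step dt :
  energy (rbm_step Lambda gamma eps sigma L p dt P X) =
  energy X + dt ^+ 2 * energy_drift.
Proof.
pose a := dt * batch_factor.
transitivity (energy X
    - 2 * a * \sum_i weight X i * dot (velocity X i) (drift i)
    + a ^+ 2 * \sum_i weight X i * dot (drift i) (drift i)); last first.
  by rewrite sum_dot_drift mulr0 subr0 /energy_drift mulrA -exprMn.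
rewrite /energy !mulr_sumr -sumrB -big_split; apply: eq_bigr => i _ /=.
rewrite -/(drift i) -/batch_factor -/a !enorm_sqr dot_subZ.
by ring.
Qed.

End Step.

Lemma mass_run (R : realType) (d : nat) (Lambda gamma eps sigma L : R)
    (no p : nat) (dt : R) (B : nat -> {set {set 'I_(no ^ d)}})
    (X0 : particles R d (no ^ d)) (n : nat) :
  mass (rbm_run Lambda gamma eps sigma L p dt B X0 n) = mass X0.
Proof. by elim: n. Qed.

(* C is chosen before dt: it sees only the current configuration (weights and
   velocities), the current batches and the fixed parameters. *)
Theorem proposition3p3 (R : realType) (d : nat)
    (Lambda gamma eps sigma L : R) (no p : nat)
    (hd : (2 <= d)%N) (hLambda : 0 < Lambda)
    (hgamma : - d%:R - 1 <= gamma <= 1)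
    (heps : 0 < eps) (hsigma : 0 < sigma) (hL : 0 < L)
    (hno : (0 < no)%N) (hp : (2 <= p)%N) (hpN : (p %| no ^ d)%N) :
  exists C : particles R d (no ^ d) -> {set {set 'I_(no ^ d)}} -> R,
  forall (dt : R) (B : nat -> {set {set 'I_(no ^ d)}})
         (X0 : particles R d (no ^ d)),
    0 < dt ->
    (forall n : nat, is_batching p (B n)) ->
    (forall i : 'I_(no ^ d), 0 < weight X0 i) ->
    let X := rbm_run Lambda gamma eps sigma L p dt B X0 in
    forall n : nat,
      [/\ mass (X n) = mass X0,
          dt^-1 *: (momentum (X n.+1) - momentum (X n)) = 0 &
          `|(energy (X n.+1) - energy (X n)) / dt| <= C (X n) (B n) * dt].
Proof.
exists (fun X P => `|energy_drift Lambda gamma eps sigma L no p P X|).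
move=> dt B X0 dt_gt0 B_batch _ X n.
have [B_part _ _] := B_batch n.
split.
- exact: mass_run.
- by rewrite /X /= momentum_step // subrr scaler0.
- rewrite /X /= energy_step // addrAC subrr add0r mulrAC expr2.
  by rewrite mulfK ?gt_eqF // normrM (gtr0_norm dt_gt0) mulrC.
Qed.
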